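(* Consider the problem \textsc{ConRMC}: given a finite alphabet $\Sigma$, an incomplete matrix $\mathbf{S} \in (\Sigma \cup \{*\})^{n \times \ell}$ and nonnegative integers $d_1, \dots, d_n$, decide whether there is a vector $v \in \Sigma^\ell$ such that $\delta(v, \mathbf{S}[i]) \le d_i$ for each $i \in [n]$. For $d := \max_{i \in [n]} d_i$, \textsc{ConRMC} can be solved in $O((d+1)^\ell \cdot n\ell)$ time.
   Context: The symbol $*$ denotes a missing entry and is not in $\Sigma$. $\mathbf{S}[i]$ denotes the $i$-th row. For $v, v' \in (\Sigma \cup \{*\})^\ell$, $\delta(v,v')$ is the number of positions $j$ with $v[j] \ne v'[j]$, $v[j]\ne *$ and $v'[j]\ne *$. $[n]=\{1,\dots,n\}$. *)

(* Defs.v *)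
From mathcomp Require Import all_boot all_order all_algebra.

Set Implicit Arguments.
Unset Strict Implicit.
Unset Printing Implicit Defensive.

(* Entries live in [option Sigma]; [None] is the missing entry "*". *)
Definition delta (Sigma : finType) (l : nat) (u v : 'rV[option Sigma]_l) : nat :=
  #|[set j : 'I_l |
      [&& u ord0 j != v ord0 j, u ord0 j != None & v ord0 j != None]]|.

Definition conrmc (Sigma : finType) (n l : nat)
    (S : 'M[option Sigma]_(n, l)) (d : 'I_n -> nat) : bool :=
  [exists v : 'rV[Sigma]_l,
    [forall i : 'I_n, delta (map_mx Some v) (row i S) <= d i]].

(* The model of computation is the random access machine with the uniform cost
   criterion (each instruction costs 1), addition and truncated subtraction
   being the only arithmetic operations.  A program addresses the registers
   directly, hence uses a fixed finite number of them, and addresses the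
   memory indirectly, through the contents of a register. *)
Inductive instr : Type :=
  | Iconst of nat & nat
  | Iadd of nat & nat & nat
  | Isub of nat & nat & nat
  | Iload of nat & nat
  | Istore of nat & nat
  | Ijumppos of nat & nat.

Definition program := seq instr.

Record config := Config { pc : nat; reg : nat -> nat; mem : nat -> nat }.

Definition upd (f : nat -> nat) (a v : nat) : nat -> nat :=
  fun x => if x == a then v else f x.

Definition exec (i : instr) (c : config) : config :=
  let: Config k r m := c in
  match i with
  | Iconst a v => Config k.+1 (upd r a v) m
  | Iadd a b b' => Config k.+1 (upd r a (r b + r b')) m
  | Isub a b b' => Config k.+1 (upd r a (r b - r b')) m
  | Iload a b => Config k.+1 (upd r a (m (r b))) m
  | Istore a b => Config k.+1 r (upd m (r a) (r b))
  | Ijumppos a k' => Config (if 0 < r a then k' else k.+1) r m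
  end.

(* The machine halts when the program counter leaves the program. *)
Definition halted (p : program) (c : config) : bool := size p <= pc c.

Definition step (p : program) (c : config) : config :=
  if onth p (pc c) is Some i then exec i c else c.

Definition init (input : seq nat) : config :=
  Config 0 (fun=> 0) (fun a => nth 0 input a).

(* On [input], [p] halts after at most [T] instructions, with the truth value
   of [b] (1 for yes, 0 for no) in register 0. *)
Definition decides_within (p : program) (input : seq nat) (T : nat) (b : bool) :
    Prop :=
  exists t : nat,
    let c := iter t (step p) (init input) in
    [/\ t <= T, halted p c & reg c 0 = nat_of_bool b].

Definition entry_code (Sigma : finType) (x : option Sigma) : nat :=
  if x is Some a then (enum_rank a).+1 else 0.

(* n, l, |Sigma|, then d_1, ..., d_n, then the matrix in row-major order. *)
Definition encode (Sigma : finType) (n l : nat)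
    (S : 'M[option Sigma]_(n, l)) (d : 'I_n -> nat) : seq nat :=
  [:: n; l; #|Sigma|] ++ [seq d i | i <- enum 'I_n]
    ++ [seq entry_code (S i j) | i <- enum 'I_n, j <- enum 'I_l].

(* Main.v *)
Require Import Defs.
From mathcomp Require Import all_boot all_order all_algebra zify.

(** Let [v] be a solution and go through the rows in order, keeping a partial
    vector [w] that agrees with [v].  Call the number of entries of row [i] that
    are neither missing nor equal to an entry already fixed in [w] its count; if
    the count exceeds [d_i], then at least the excess many of its undecided
    entries agree with [v], and at most [d_i] disagree.  Hence a single pass over
    the row can fix the excess many columns to the entries of the row, skipping
    before each one at most [d_i] candidates, namely those that differ from [v].
    Once the count of a row is at most its radius, it stays so, and any
    completion of the final [w] is a solution.  Each fixed column is preceded by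
    one number of skips in [0..dmax], and at most [l] columns get fixed, so it is
    enough to try all [(dmax + 1) ^ l] sequences of [l] such numbers, enumerated
    by a counter in base [dmax + 1]; each trial costs O(n l). *)

Set Implicit Arguments.
Unset Strict Implicit.
Unset Printing Implicit Defensive.

(** * Trials on rows of entry codes *)

(* In a row [xs] the code 0 is a missing entry, in a partial vector [ws] it is an
   undecided one, which counts as a mismatch. *)
Definition mism (xs ws : seq nat) : nat :=
  count (fun p => (p.1 != 0) && (p.1 != p.2)) (zip xs ws).

Definition extends (ws vs : seq nat) : bool :=
  all2 (fun y v => (y == 0) || (y == v)) ws vs.

(* [need] columns remain to be fixed in the current row, and [head 0 t]
   candidates remain to be skipped before the next of them.  When [need] is 0 the
   entry [head 0 t] is still unused, and serves the next row. *)
Definition scan1 (x y need : nat) (t : seq nat) : nat * nat * seq nat :=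
  if [&& 0 < need, 0 < x & y == 0] then
    if head 0 t == 0 then (x, need.-1, behead t)
    else (y, need, (head 0 t).-1 :: behead t)
  else (y, need, t).

Fixpoint scan (xs ws : seq nat) (need : nat) (t : seq nat) :
    seq nat * nat * seq nat :=
  match xs, ws with
  | x :: xs', y :: ws' =>
    let: (y', need', t') := scan1 x y need t in
    let: (ws'', need'', t'') := scan xs' ws' need' t' in
    (y' :: ws'', need'', t'')
  | _, _ => (ws, need, t)
  end.

Fixpoint sim (ds : seq nat) (xss : seq (seq nat)) (ws t : seq nat) : bool :=
  match ds, xss with
  | d :: ds', xs :: xss' =>
    let: (ws', need, t') := scan xs ws (mism xs ws - d) t in
    (need == 0) && sim ds' xss' ws' t'
  | _, _ => true
  end.

Definition within_radii (ds : seq nat) (xss : seq (seq nat)) (v : seq nat) :=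
  all2 (fun d xs => mism xs v <= d) ds xss.

(** * Soundness of a trial *)

Lemma extends_refl ws : extends ws ws.
Proof. by elim: ws => //= y ws ->; rewrite eqxx orbT. Qed.

Lemma extends_size ws vs : extends ws vs -> size ws = size vs.
Proof.
by elim: ws vs => [|y ws IH] [|v vs] //= /andP[_ /IH ->].
Qed.

Lemma extends_trans us ws vs : extends us ws -> extends ws vs -> extends us vs.
Proof.
elim: us ws vs => [|u us IH] [|y ws] [|v vs] //= /andP[Huy /IH H] /andP[Hyv /H ->].
by rewrite andbT; case/orP: Huy => [->//|/eqP ->].
Qed.

(** An undecided entry is 0 and already mismatches every nonzero code, so deciding it cannot raise
    the count. *)
Lemma mism_extends xs ws vs : extends ws vs -> mism xs vs <= mism xs ws.
Proof.
elim: xs ws vs => [|x xs IH] [|y ws] [|v vs] //= /andP[Hy /IH].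
by rewrite /mism /= => H; case/orP: Hy => /eqP->; lia.
Qed.

Lemma size_scan xs ws need t : size (scan xs ws need t).1.1 = size ws.
Proof.
elim: xs ws need t => [|x xs IH] [|y ws] need t //=.
case: (scan1 x y need t) => [[y' n1] t1].
by move: (IH ws n1 t1); case: (scan _ _ _ _) => [[ws' n2] t2] /= ->.
Qed.

(** Fixing a column turns one mismatch into a match and lowers [need] by one; the last equation
    states this invariance of the difference without subtraction. *)
Lemma scan_sound s xs ws need t : size xs = size ws ->
  all (leq^~ s) xs -> all (leq^~ s) ws ->
  let: (ws', need', t') := scan xs ws need t in
  [/\ extends ws ws', all (leq^~ s) ws' &
      mism xs ws' + need = mism xs ws + need'].
Proof.
elim: xs ws need t => [|x xs IH] [|y ws] need t //= [Hs].
move=> /andP[Hx Hxs] /andP[Hy Hws].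
case E: (scan1 x y need t) => [[y' n1] t1].
move: (IH ws n1 t1 Hs Hxs Hws); case: (scan _ _ _ _) => [[ws' n2] t2] [H1 H2 H3].
move: E; rewrite /scan1; case: ifP => [/and3P[Hn Hx0 /eqP y0]|_].
  case: ifP => _ [? ? ?]; subst; split; rewrite /= ?H1 ?H2 ?Hx //;
  rewrite /mism /= in H3 *; lia.
by case=> ? ? ?; subst; split; rewrite /= ?H1 ?H2 ?Hy ?eqxx ?orbT //;
  rewrite /mism /= in H3 *; lia.
Qed.

(** A row that ends with [need] equal to 0 has a count of at most [d], and later rows only extend
    the partial vector. The witness is the final partial vector, possibly still with zeros. *)
Lemma sim_sound s ds xss ws t :
  all (fun xs => (size xs == size ws) && all (leq^~ s) xs) xss ->
  size ds = size xss -> all (leq^~ s) ws -> sim ds xss ws t ->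
  exists v, [/\ extends ws v, all (leq^~ s) v & within_radii ds xss v].
Proof.
elim: ds xss ws t => [|d ds IH] [|xs xss] ws t //=.
  by move=> _ _ Hws _; exists ws; rewrite extends_refl.
move=> /andP[/andP[/eqP Hs Hx] Hxss] [Hd] Hws.
move: (scan_sound (mism xs ws - d) t Hs Hx Hws).
case: (scan _ _ _ _) => [[ws' need] t'] [He Hws' Hm] /andP[/eqP n0 Hsim].
rewrite (extends_size He) in Hxss.
have [v [Hv Hvs Hr]] := IH _ _ _ Hxss Hd Hws' Hsim.
exists v; split=> //; first exact: extends_trans He Hv.
rewrite /within_radii /= -/(within_radii _ _ _) Hr andbT.
have := mism_extends xs Hv; lia.
Qed.

(** * Completeness: every solution is found by some guess *)

Fixpoint avail (xs ws vs : seq nat) : nat :=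
  match xs, ws, vs with
  | x :: xs', y :: ws', v :: vs' =>
    [&& x != 0, y == 0 & x == v] + avail xs' ws' vs'
  | _, _, _ => 0
  end.

(** A mismatch with [ws] either persists in [vs] or sits in an undecided column where the row agrees
    with [vs]. So if [vs] is within radius, the excess is at most the number of columns that can be
    fixed correctly. *)
Lemma mism_avail xs ws vs : extends ws vs ->
  mism xs ws = avail xs ws vs + mism xs vs.
Proof.
elim: xs ws vs => [|x xs IH] [|y ws] [|v vs] //= /andP[Hy /IH].
by rewrite /mism /= => ->; case/orP: Hy => /eqP->; lia.
Qed.

(** The guess skips just the candidates that disagree with [vs]; they are mismatches of the row,
    which bounds each number of skips. Each entry used decides one column, which bounds the length
    of the guess over all rows. *)
Lemma scan_complete xs ws vs need :
  extends ws vs -> need <= avail xs ws vs ->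
  exists p ws', [/\ all (leq^~ (mism xs vs)) p, size p = need, extends ws' vs,
    size p + count_mem 0 ws' <= count_mem 0 ws &
    forall t, scan xs ws need (p ++ t) = (ws', 0, t)].
Proof.
elim: xs ws vs need => [|x xs IH] [|y ws] [|v vs] need //=;
  try by rewrite leqn0 => H /eqP ->; exists [::], [::]; split.
  rewrite leqn0 => H /eqP ->; exists [::], (y :: ws); split=> //.
move=> /andP[Hy He] Hn.
have mono p : all (leq^~ (mism xs vs)) p -> all (leq^~ (mism (x :: xs) (v :: vs))) p.
  by apply: sub_all => z; rewrite /mism /=; lia.
case C: [&& 0 < need, 0 < x & y == 0]; last first.
  have [|p [ws' [H1 H2 H3 H4 H5]]] := IH ws vs need He; first by lia.
  exists p, (y :: ws'); split=> //=; first exact: mono.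
  - by rewrite Hy.
  - by rewrite addnCA leq_add2l.
  - by move=> t; rewrite /scan1 C H5.
have [n0 x0 /eqP y0] := and3P C; subst y.
case: (eqVneq x v) => [xv|xv].
  subst v; have [|p [ws' [H1 H2 H3 H4 H5]]] := IH ws vs need.-1 He; first by lia.
  exists (0 :: p), (x :: ws'); split=> //=; first exact: mono.
  - lia.
  - by rewrite eqxx orbT.
  - by rewrite eqn0Ngt x0 add0n addSn add1n ltnS.
  - by move=> t; rewrite /scan1 C /= H5.
(* A disagreeing candidate is skipped by raising the first number of the guess, which exists as
   [need] is positive. The bound survives because this column is itself a mismatch. *)
have [|[|c p] [ws' [H1 H2 H3 H4 H5]]] := IH ws vs need He; first by lia.
  by move: H2 n0 => /= <-.
exists (c.+1 :: p), (0 :: ws'); split=> //=.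
- move: H1 => /= /andP[H1 H1']; rewrite mono // andbT.
  by rewrite /mism /= in H1 *; lia.
- by move: H4 => /=; lia.
- by move=> t; rewrite /scan1 C /=; move: (H5 t) => /= ->.
Qed.

Lemma sim_complete D ds xss ws vs : extends ws vs ->
  all (leq^~ D) ds -> within_radii ds xss vs ->
  exists p, [/\ all (leq^~ D) p, size p <= count_mem 0 ws &
    forall t, sim ds xss ws (p ++ t)].
Proof.
elim: ds xss ws => [|d ds IH] [|xs xss] ws //=; try by exists [::].
move=> He /andP[Hd Hds] /andP[Hm Hr].
have Hn : mism xs ws - d <= avail xs ws vs.
  by rewrite (mism_avail xs He); lia.
have [p [ws' [H1 H2 H3 H4 H5]]] := scan_complete He Hn.
have [p' [G1 G2 G3]] := IH xss ws' H3 Hds Hr.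
exists (p ++ p'); split.
- by rewrite all_cat G1 andbT; apply: sub_all H1 => z; lia.
- by rewrite size_cat (leq_trans _ H4) // leq_add2l.
- by move=> t; rewrite -catA H5 G3.
Qed.

Definition feasible (s l : nat) ds xss : Prop :=
  exists v, [/\ size v = l, all (fun y => 0 < y <= s) v & within_radii ds xss v].

Definition accepted (D : nat) ds xss (l : nat) : Prop :=
  exists b, [/\ size b = l, all (leq^~ D) b & sim ds xss (nseq l 0) b].

Lemma accepted_feasibleP s D l ds xss : 0 < s ->
  all (fun xs => (size xs == l) && all (leq^~ s) xs) xss ->
  size ds = size xss -> all (leq^~ D) ds ->
  accepted D ds xss l <-> feasible s l ds xss.
Proof.
move=> s0 Hxss Hsz HD; split=> [[b [Hb _ Hsim]]|[v [Hv Hvs Hr]]].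
  have [|||v [He Hvs Hr]] := @sim_sound s ds xss (nseq l 0) b _ _ _ Hsim => //.
  - by rewrite size_nseq.
  - by rewrite all_nseq orbT.
  (* Columns still undecided receive the code 1, which is available since [0 < s]. *)
  have Hv : extends v [seq maxn 1 y | y <- v].
    by elim: (v) => [|y u IH] //=; rewrite IH andbT; lia.
  exists [seq maxn 1 y | y <- v]; split.
  - by rewrite size_map -(extends_size He) size_nseq.
  - by rewrite all_map; apply: sub_all Hvs => y /=; lia.
  - elim: ds xss Hr {Hxss Hsz HD Hsim} => [|d ds IH] [|xs xss] //= /andP[H1 H2].
    by rewrite /within_radii /= -/(within_radii _ _ _) IH // andbT
      (leq_trans (mism_extends _ Hv)).
have He : extends (nseq l 0) v by rewrite -Hv; elim: (v).
have [p [H1 H2 H3]] := sim_complete He HD Hr.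
rewrite count_nseq /= mul1n in H2.
(* Acceptance holds whatever follows [p], so zeros can pad it to length [l]. *)
exists (p ++ nseq (l - size p) 0); split=> //.
- by rewrite size_cat size_nseq subnKC.
- by rewrite all_cat H1 all_nseq orbT.
Qed.

(* Digits in base [D + 1], least significant first. *)
Definition inc1 (D carry x : nat) : nat * nat :=
  (x + carry - D, if D < x + carry then 0 else x + carry).

Fixpoint inc (D carry : nat) (b : seq nat) : nat * seq nat :=
  if b is x :: b' then
    let: (carry', x') := inc1 D carry x in
    let: (carry'', b'') := inc D carry' b' in (carry'', x' :: b'')
  else (carry, [::]).

Fixpoint value (D : nat) (b : seq nat) : nat :=
  if b is x :: b' then x + D.+1 * value D b' else 0.

Lemma value_lt D b : all (leq^~ D) b -> value D b < D.+1 ^ size b.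
Proof.
elim: b => //= x b IH /andP[Hx /IH]; rewrite expnS; nia.
Qed.

(** Digit by digit, by uniqueness of quotient and remainder modulo [D.+1]. *)
Lemma value_inj D b b' : size b = size b' -> all (leq^~ D) b ->
  all (leq^~ D) b' -> value D b = value D b' -> b = b'.
Proof.
elim: b b' => [|x b IH] [|x' b'] //= [Hs] /andP[Hx Hb] /andP[Hx' Hb'] E.
have : edivn (value D b * D.+1 + x) D.+1 = edivn (value D b' * D.+1 + x') D.+1.
  by congr (edivn _ _); lia.
by rewrite !edivn_eq // => -[/(IH _ Hs Hb Hb') -> ->].
Qed.

(** For [x <= D] and [carry <= 1], the truncated [x + carry - D] is 1 exactly when the digit
    overflows. *)
Lemma incP D carry b : all (leq^~ D) b -> carry <= 1 ->
  let: (carry', b') := inc D carry b in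
  [/\ carry' <= 1, size b' = size b, all (leq^~ D) b' &
      value D b' + carry' * D.+1 ^ size b = value D b + carry].
Proof.
elim: b carry => [|x b IH] carry; first by rewrite /= muln1.
rewrite /inc -/inc /inc1 /= => /andP[Hx Hb] Hc.
have Hc' : x + carry - D <= 1 by lia.
move: (IH _ Hb Hc'); case: (inc _ _ _) => c' b' [H1 H2 H3 H4] /=.
split; rewrite ?H2 ?H3 //; first by case: ifP; lia.
by rewrite expnS; case: ifP; nia.
Qed.

(** * Structured programs and their running time *)

(* [Unless a c] runs [c] if register [a] is 0; [Loop c a] runs [c] at least once,
   until register [a] is 0.  Neither needs an unconditional jump. *)
Inductive cmd : Type :=
  | Block of seq instr
  | Seq of cmd & cmd
  | Unless of nat & cmd
  | Loop of cmd & nat.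

Infix ";;" := Seq (at level 60, right associativity).

Fixpoint csize (c : cmd) : nat :=
  match c with
  | Block is_ => size is_
  | Seq c1 c2 => csize c1 + csize c2
  | Unless _ c => (csize c).+1
  | Loop c _ => (csize c).+1
  end.

(** Jump targets are absolute, hence the parameter [k], the address of the first instruction. *)
Fixpoint compile (k : nat) (c : cmd) : program :=
  match c with
  | Block is_ => is_
  | Seq c1 c2 => compile k c1 ++ compile (k + csize c1) c2
  | Unless a c => Ijumppos a (k.+1 + csize c) :: compile k.+1 c
  | Loop c a => rcons (compile k c) (Ijumppos a k)
  end.

Lemma size_compile k c : size (compile k c) = csize c.
Proof.
elim: c k => //= [c1 IH1 c2 IH2|a c IH|c IH a] k.
- by rewrite size_cat IH1 IH2.
- by rewrite IH.
- by rewrite size_rcons IH.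
Qed.

Definition target (i : instr) : seq nat :=
  match i with
  | Iconst a _ | Iadd a _ _ | Isub a _ _ | Iload a _ => [:: a]
  | Istore _ _ | Ijumppos _ _ => [::]
  end.

Fixpoint modified (c : cmd) : seq nat :=
  match c with
  | Block is_ => flatten [seq target i | i <- is_]
  | Seq c1 c2 => modified c1 ++ modified c2
  | Unless _ c | Loop c _ => modified c
  end.

Fixpoint code_at (p : program) (k : nat) (s : program) : Prop :=
  if s is i :: s' then onth p k = Some i /\ code_at p k.+1 s' else True.

Lemma code_at_cat p k s1 s2 :
  code_at p k (s1 ++ s2) <-> code_at p k s1 /\ code_at p (k + size s1) s2.
Proof.
elim: s1 k => /= [|i s1 IH] k; first by rewrite addn0; tauto.
by rewrite IH addnS; tauto.
Qed.

Lemma code_at_self p : code_at p 0 p.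
Proof.
(* The induction runs on the suffix, with a prefix that absorbs the instructions already passed. *)
rewrite -[in X in code_at X]/([::] ++ p) -[0]/(size (Nil instr)).
elim: p [::] => //= i p IH pre; split.
  by rewrite onth_cat ltnn subnn.
by rewrite -cat_rcons -(size_rcons pre i).
Qed.

Lemma step_at p k i r m : onth p k = Some i ->
  step p (Config k r m) = exec i (Config k r m).
Proof. by rewrite /step => /= ->. Qed.

(* A total Hoare triple with time bound [N]; the frame condition on registers is
   built in, so that loop invariants need not mention constant registers. *)
Definition runs (c : cmd) (r m : nat -> nat) (N : nat)
    (Q : (nat -> nat) -> (nat -> nat) -> Prop) : Prop :=
  forall p k, code_at p k (compile k c) ->
  exists t r' m', [/\ t <= N,
    iter t (step p) (Config k r m) = Config (k + csize c) r' m',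
    forall q, q \notin modified c -> r' q = r q & Q r' m'].

Lemma runs_weaken c r m N N' (Q Q' : (nat -> nat) -> (nat -> nat) -> Prop) :
  runs c r m N Q -> N <= N' ->
  (forall r' m', (forall q, q \notin modified c -> r' q = r q) ->
    Q r' m' -> Q' r' m') ->
  runs c r m N' Q'.
Proof.
move=> H HN HQ p k Hp; have [t [r' [m' [H1 H2 H3 H4]]]] := H p k Hp.
by exists t, r', m'; split=> //; [exact: leq_trans HN|exact: HQ].
Qed.

Lemma runs_le c r m N N' Q : runs c r m N Q -> N <= N' -> runs c r m N' Q.
Proof. by move=> H HN; apply: runs_weaken H HN _. Qed.

Lemma runs_seq c1 c2 r m N1 N2 Q1 Q :
  runs c1 r m N1 Q1 ->
  (forall r' m', (forall q, q \notin modified c1 -> r' q = r q) ->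
    Q1 r' m' -> runs c2 r' m' N2 Q) ->
  runs (c1 ;; c2) r m (N1 + N2) Q.
Proof.
move=> H1 H2 p k /= /code_at_cat[]; rewrite size_compile => Hp1 Hp2.
have [t1 [r1 [m1 [T1 E1 F1 P1]]]] := H1 p k Hp1.
have [t2 [r2 [m2 [T2 E2 F2 P2]]]] := H2 r1 m1 F1 P1 _ _ Hp2.
exists (t2 + t1), r2, m2; split=> //; first by lia.
  by rewrite iterD E1 E2 addnA.
by move=> q; rewrite mem_cat negb_or => /andP[q1 q2]; rewrite F2 ?F1.
Qed.

Lemma runs_unless a c r m N Q :
  (r a = 0 -> runs c r m N Q) -> (0 < r a -> Q r m) ->
  runs (Unless a c) r m N.+1 Q.
Proof.
move=> H0 H1 p k /= [Hi Hp]; case: (posnP (r a)) => Ha.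
  have [t [r' [m' [T E F P]]]] := H0 Ha _ _ Hp.
  exists t.+1, r', m'; split=> //.
  by rewrite iterSr (step_at _ _ Hi) /= Ha E addSnnS.
exists 1, r, m; split=> //; last exact: H1.
by rewrite [iter 1 _ _](step_at _ _ Hi) /= Ha addSnnS.
Qed.

(** The index of [I] is a measure that drops with every repetition: at most [k.+1] rounds, each
    paying one more instruction for the test. *)
Lemma runs_loop c a r0 m0 N Q (I : nat -> (nat -> nat) -> (nat -> nat) -> Prop) :
  (forall k r m, (forall q, q \notin modified c -> r q = r0 q) -> I k r m ->
    runs c r m N (fun r' m' => if r' a == 0 then Q r' m'
                               else exists2 k', k' < k & I k' r' m')) ->
  forall k, I k r0 m0 -> runs (Loop c a) r0 m0 (k.+1 * N.+1) Q.
Proof.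
move=> H k Hk p j /=; rewrite -cats1 => /code_at_cat[Hp [Hi _]].
rewrite size_compile in Hi.
have : forall q, q \notin modified c -> r0 q = r0 q by [].
(* The current state is generalized, but the frame hypothesis keeps [r0] as its reference. *)
move: {-3}r0 m0 Hk => r m; elim/ltn_ind: k r m => k IH r m Hk Hr.
have [t [r' [m' [T E F P]]]] := H k r m Hr Hk _ _ Hp.
have Hr' q : q \notin modified c -> r' q = r0 q by move=> Hq; rewrite F ?Hr.
have E' : iter t.+1 (step p) (Config j r m) =
          Config (if 0 < r' a then j else (j + csize c).+1) r' m'.
  by rewrite iterS E (step_at _ _ Hi).
move: P; case: eqP => Ha.
  exists t.+1, r', m'; split=> //; last by rewrite E' Ha /= addnS.
  by rewrite mulSn; lia.
case=> k' Hk' HI; have [t2 [r2 [m2 [T2 E2 F2 P2]]]] := IH k' Hk' r' m' HI Hr'.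
exists (t2 + t.+1), r2, m2; split=> //.
- by nia.
- by rewrite iterD E' lt0n; move/eqP: Ha => ->.
- by move=> q Hq; rewrite F2 // F.
Qed.

(* [set_reg] is [upd]: naming it apart lets register contents be computed by
   simplification while memory updates stay folded. *)
Definition set_reg (r : nat -> nat) (a v : nat) : nat -> nat :=
  fun x => if x == a then v else r x.

Definition exec_block1 (s : (nat -> nat) * (nat -> nat)) (i : instr) :=
  let: (r, m) := s in
  match i with
  | Iconst a v => (set_reg r a v, m)
  | Iadd a b b' => (set_reg r a (r b + r b'), m)
  | Isub a b b' => (set_reg r a (r b - r b'), m)
  | Iload a b => (set_reg r a (m (r b)), m)
  | Istore a b => (r, upd m (r a) (r b))
  | Ijumppos _ _ => (r, m)
  end.

Definition straight (i : instr) : bool :=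
  if i is Ijumppos _ _ then false else true.

(** Symbolic execution: the final state is a fold, which simplification computes. *)
Lemma runs_block is_ r m Q : all straight is_ ->
  (let s := foldl exec_block1 (r, m) is_ in Q s.1 s.2) ->
  runs (Block is_) r m (size is_) Q.
Proof.
move=> Hs HQ p k /= Hp.
exists (size is_).
exists (foldl exec_block1 (r, m) is_).1, (foldl exec_block1 (r, m) is_).2.
split=> // {HQ}.
  elim: is_ k r m Hs Hp => [|i s IH] k r m /=; first by rewrite addn0.
  move=> /andP[Hi Hs] [Hki Hp].
  rewrite -iterS iterSr (step_at _ _ Hki).
  case: i Hi {Hki} => //= *; by rewrite (IH k.+1) // addSnnS.
move=> q; elim: is_ r m Hs {Hp} => //= i s IH r m /andP[Hi Hs].
rewrite mem_cat negb_or => /andP[q1 q2].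
by case: i Hi q1 => //= [a v|a b b'|a b b'|a b|a b] _; rewrite ?inE => q1;
  rewrite IH // /set_reg (negbTE q1).
Qed.

Lemma runs_cons is_ c r m N Q : all straight is_ ->
  (let s := foldl exec_block1 (r, m) is_ in runs c s.1 s.2 N Q) ->
  runs (Block is_ ;; c) r m (size is_ + N) Q.
Proof.
move=> Hs H.
apply: (runs_seq (Q1 := fun r' m' => (r', m') = foldl exec_block1 (r, m) is_)).
  by apply: runs_block => //=; case: (foldl _ _ _).
by move=> r' m' _ E; move: H; rewrite -E.
Qed.

(** * The machine program *)

Arguments set_reg r a v x /.

(* Register 0 holds the answer.  Pointers: [rW] partial vector, [rB] guess,
   [rRadius] and [rRow] current radius and row, [rQ] and [rP] the scanning
   positions, [rK] last entry of the guess that was loaded into [rSkip].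
   Down-counters: [rRows], [rCnt]. *)
Local Notation rAns := 0 (only parsing).
Local Notation rOne := 1 (only parsing).
Local Notation rN := 2 (only parsing).
Local Notation rL := 3 (only parsing).
Local Notation rSigma := 4 (only parsing).
Local Notation rD := 5 (only parsing).
Local Notation rW := 6 (only parsing).
Local Notation rB := 7 (only parsing).
Local Notation rRows := 8 (only parsing).
Local Notation rCnt := 9 (only parsing).
Local Notation rQ := 10 (only parsing).
Local Notation rP := 11 (only parsing).
Local Notation rRadius := 12 (only parsing).
Local Notation rK := 13 (only parsing).
Local Notation rSkip := 14 (only parsing).
Local Notation rNeed := 15 (only parsing).
Local Notation rFail := 16 (only parsing).
Local Notation rX := 17 (only parsing).
Local Notation rY := 18 (only parsing).
Local Notation rT := 19 (only parsing).
Local Notation rU := 20 (only parsing).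
Local Notation rE := 21 (only parsing).
Local Notation rCarry := 22 (only parsing).
Local Notation rRow := 23 (only parsing).

(** * Arrays in memory *)

Lemma size_flatten_const (T : Type) (xss : seq (seq T)) l :
  all (fun xs => size xs == l) xss -> size (flatten xss) = size xss * l.
Proof.
by elim: xss => //= xs xss IH /andP[/eqP Hl /IH]; rewrite size_cat Hl mulSn => ->.
Qed.

Definition arr (m : nat -> nat) (a : nat) (s : seq nat) : Prop :=
  forall i, i < size s -> m (a + i) = nth 0 s i.

Lemma arr_cons m a x s : arr m a (x :: s) <-> m a = x /\ arr m (a + 1) s.
Proof.
split=> [H|[H1 H2] [|i] Hi]; last 2 first.
- by rewrite addn0.
- by rewrite -addn1 (addnC i) addnA H2.
split=> [|i Hi]; first by have := H 0 isT; rewrite addn0.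
by have := H i.+1 Hi; rewrite -[i.+1]add1n addnA.
Qed.

Lemma arr_cat m a s1 s2 :
  arr m a (s1 ++ s2) <-> arr m a s1 /\ arr m (a + size s1) s2.
Proof.
elim: s1 a => [|x s1 IH] a /=.
  by rewrite addn0; split=> [H|[]].
by rewrite !arr_cons IH -[(size s1).+1]add1n addnA; tauto.
Qed.

Lemma eq_arr m m' a s : arr m a s ->
  (forall i, a <= i < a + size s -> m' i = m i) -> arr m' a s.
Proof. by move=> H E i Hi; rewrite E ?H //; lia. Qed.

Lemma arr_upd m a s b v : arr m a s -> (b < a) || (a + size s <= b) ->
  arr (upd m b v) a s.
Proof.
by move=> H Hb; apply: eq_arr H _ => i Hi; rewrite /upd; case: eqP => //; lia.
Qed.

Lemma upd_same f a v : upd f a v a = v.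
Proof. by rewrite /upd eqxx. Qed.

Lemma upd_other f a v x : x != a -> upd f a v x = f x.
Proof. by rewrite /upd => /negbTE ->. Qed.

(** * Passes over a single row or vector *)

Definition clear_loop : cmd :=
  Loop (Block [:: Istore rP rT; Iadd rP rP rOne; Isub rCnt rCnt rOne]) rCnt.

Lemma clear_loopP l W r m : 0 < l -> r rOne = 1 -> r rT = 0 -> r rP = W ->
  r rCnt = l ->
  runs clear_loop r m (l * 4) (fun r' m' =>
    arr m' W (nseq l 0) /\ forall a, (a < W) || (W + l <= a) -> m' a = m a).
Proof.
case: l => // l _ H1 HT HP HC.
(* [j] cells are cleared and [k.+1] remain; the measure is one below the counter because a loop body
   runs at least once. *)
apply: (runs_loop (I := fun k r1 m1 => exists j,
  [/\ r1 rP = W + j, r1 rCnt = k.+1, j + k = l, arr m1 W (nseq j 0) &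
      forall a, (a < W) || (W + l.+1 <= a) -> m1 a = m a])).
  move=> k r1 m1 F [j [E1 E2 E3 E4 E5]]; apply: runs_block => //=.
  have F1 : r1 rOne = 1 by rewrite F.
  have FT : r1 rT = 0 by rewrite F.
  rewrite E1 E2 F1 FT subn1 /=.
  have A1 : arr (upd m1 (W + j) 0) W (nseq j.+1 0).
    rewrite -addn1 nseqD; apply/arr_cat; rewrite size_nseq.
    split; [by apply: arr_upd E4 _; rewrite size_nseq leqnn orbT|].
    by apply/arr_cons; rewrite upd_same.
  have A2 a : (a < W) || (W + l.+1 <= a) -> upd m1 (W + j) 0 a = m a.
    by move=> Ha; rewrite upd_other ?E5 //; lia.
  case: k => [|k] in E2 E3 *.
    by move: E3 A1 A2; rewrite addn0 => <-.
  by exists k => //; exists j.+1; split=> //; lia.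
by exists 0; split; rewrite ?addn0.
Qed.

(** Branch-free test: two truncated subtractions add up to the distance of [x] and [y]; one minus it
    detects equality, [1 - x] detects a missing entry, and one minus their sum is the indicator of a
    mismatch. *)
Definition mism_loop : cmd :=
  Loop (Block [:: Iload rX rQ; Iload rY rP; Isub rT rX rY; Isub rU rY rX;
                  Iadd rT rT rU; Isub rT rOne rT; Isub rU rOne rX;
                  Iadd rT rT rU; Isub rT rOne rT; Iadd rE rE rT;
                  Iadd rQ rQ rOne; Iadd rP rP rOne; Isub rCnt rCnt rOne]) rCnt.

Lemma mism_loopP xs ws r m : 0 < size xs -> size ws = size xs ->
  r rOne = 1 -> r rE = 0 -> r rCnt = size xs ->
  arr m (r rQ) xs -> arr m (r rP) ws ->
  runs mism_loop r m (size xs * 14) (fun r' m' =>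
    m' = m /\ r' rE = mism xs ws).
Proof.
move=> Hs Hs' H1 HE HC HQ HP; rewrite -(prednK Hs).
apply: (runs_loop (I := fun k r1 m1 => exists xr wr,
  [/\ m1 = m, r1 rCnt = k.+1, size xr = k.+1 /\ size wr = k.+1,
      arr m (r1 rQ) xr /\ arr m (r1 rP) wr &
      r1 rE + mism xr wr = mism xs ws])); last first.
  by exists xs, ws; rewrite prednK // HE.
move=> k r1 m1 F [[|x xr] [[|y wr]]] [-> EC [//= [Sx] [Sw] [/arr_cons[Ex Ax]]]].
move=> /arr_cons[Ey Ay] EE; apply: runs_block => //=.
have F1 : r1 rOne = 1 by rewrite F.
rewrite F1 EC Ex Ey subn1 /=.
set z := (X in _ + X); have Ez : z = (x != 0) && (x != y).
  by rewrite /z; lia.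
rewrite {}Ez; case: k => [|k] in EC Sx Sw *; rewrite /=.
  split=> //; move: EE; rewrite (size0nil Sx) (size0nil Sw) /mism /=; lia.
exists k => //; exists xr, wr; split=> //.
by move: EE; rewrite /mism /=; lia.
Qed.

(** The first [rT] is 0 exactly at a candidate while [need] is positive. [rU] records whether the
    skip count was 0 before [rSkip] is reloaded, so that exactly one of the two inner branches
    runs. *)
Definition scan_step : cmd :=
  Block [:: Iload rX rQ; Iload rY rP; Isub rT rOne rNeed;
            Isub rU rOne rX; Iadd rT rT rU; Iadd rT rT rY] ;;
  Unless rT
    (Block [:: Isub rU rOne rSkip] ;;
     Unless rSkip (Block [:: Istore rP rX; Iadd rK rK rOne;
                             Iload rSkip rK; Isub rNeed rNeed rOne]) ;;
     Unless rU (Block [:: Isub rSkip rSkip rOne])).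

(* The unread part of the guess: its first entry, which the scan counts down,
   is kept in a register [skip], the others follow the address [k]. *)
Definition guess_at (m : nat -> nat) (k skip : nat) (t : seq nat) : Prop :=
  skip = head 0 t /\ forall i, m (k + i.+1) = nth 0 (behead t) i.

(** [lo] separates the partial vector from the unread guess: the only store goes below it. *)
Lemma scan_stepP x y r m t lo : r rOne = 1 -> r rP < lo -> lo <= r rK ->
  m (r rQ) = x -> m (r rP) = y -> guess_at m (r rK) (r rSkip) t ->
  runs scan_step r m 15
   (fun r' m' => let: (y', need', t') := scan1 x y (r rNeed) t in
     [/\ r' rNeed = need', lo <= r' rK, guess_at m' (r' rK) (r' rSkip) t',
         m' (r rP) = y' & forall a, a != r rP -> m' a = m a]).
Proof.
move=> H1 HP HK Hx Hy [G1 G2].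
apply: (@runs_le _ _ _ (6 + (1 + (5 + 2)).+1)) => //.
apply: runs_cons => //=; rewrite Hx Hy H1 /scan1.
have -> : [&& 0 < r rNeed, 0 < x & y == 0] = ((1 - r rNeed) + (1 - x) + y == 0).
  by lia.
apply: runs_unless => /= HT; last by rewrite eqn0Ngt HT.
rewrite HT eqxx; apply: runs_cons => //=.
apply: (runs_seq (Q1 := fun r' m' => r' rU = 1 - r rSkip /\
   if r rSkip == 0 then
     [/\ r' rNeed = (r rNeed).-1, lo <= r' rK,
         guess_at m' (r' rK) (r' rSkip) (behead t),
         m' (r rP) = x & forall a, a != r rP -> m' a = m a]
   else [/\ r' rNeed = r rNeed, r' rK = r rK, r' rSkip = r rSkip & m' = m])).
  apply: (@runs_unless _ _ _ _ 4) => /= HS; last by rewrite eqn0Ngt HS H1.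
  apply: runs_block => //=; rewrite H1 HS eqxx; split=> //; split.
  - by rewrite subn1.
  - lia.
  - have G i : upd m (r rP) x (r rK + 1 + i) = nth 0 (behead t) i.
      by rewrite upd_other ?(addnAC _ 1) ?addn1 -?addnS ?G2 //; lia.
    split; first by rewrite -nth0 -G addn0.
    by move=> i; rewrite G [RHS]nth_behead.
  - by rewrite upd_same.
  - by move=> a Ha; rewrite upd_other.
move=> r' m' F [EU]; have F1 : r' rOne = 1 by rewrite F.
rewrite -G1; case: (posnP (r rSkip)) => HS.
  move=> HH; rewrite HS in EU.
  by apply: (@runs_unless _ _ _ _ 1) => /= HU; [rewrite HU in EU|].
move=> -[E1 E2 E3 ->].
apply: (@runs_unless _ _ _ _ 1) => /= HU; last by lia.
apply: runs_block => //=; rewrite E1 E2 E3; split=> //.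
by rewrite F1 subn1.
Qed.

Definition scan_loop : cmd :=
  Loop (scan_step ;;
        Block [:: Iadd rQ rQ rOne; Iadd rP rP rOne; Isub rCnt rCnt rOne]) rCnt.

Lemma scan_loopP xs ws t W r m : 0 < size xs -> size ws = size xs ->
  r rOne = 1 -> r rCnt = size xs -> r rP = W ->
  arr m (r rQ) xs -> arr m W ws -> r rQ + size xs <= W ->
  W + size xs <= r rK -> guess_at m (r rK) (r rSkip) t ->
  runs scan_loop r m (size xs * 19) (fun r' m' =>
    let: (ws', need', t') := scan xs ws (r rNeed) t in
    [/\ r' rNeed = need', W + size xs <= r' rK,
        guess_at m' (r' rK) (r' rSkip) t', arr m' W ws' &
        forall a, (a < W) || (W + size xs <= a) -> m' a = m a]).
Proof.
move=> Hs Hs' H1 HC HP HQ HW Hd HK HG; rewrite -[X in runs _ _ _ (X * _)](prednK Hs).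
case Escan: (scan xs ws (r rNeed) t) => [[wsF needF] tF].
(* [wd] is the part of the vector already scanned; scanning the rest [xr], [wr] from the current
   state must complete it to the overall outcome. *)
apply: (runs_loop (I := fun k r1 m1 => exists xr wr wd t1,
  [/\ [/\ r1 rCnt = k.+1, size xr = k.+1, size wr = k.+1,
          size wd + k.+1 = size xs & r1 rP = W + size wd],
      [/\ arr m1 (r1 rQ) xr, r1 rQ + size xr <= W, arr m1 W (wd ++ wr) &
          forall a, (a < W) || (W + size xs <= a) -> m1 a = m a],
      W + size xs <= r1 rK /\ guess_at m1 (r1 rK) (r1 rSkip) t1 &
      let: (ws', need', t') := scan xr wr (r1 rNeed) t1 in
      (wsF, needF, tF) = (wd ++ ws', need', t')])); last first.
  by exists xs, ws, [::], t; rewrite prednK // addn0 Escan.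
move=> k r1 m1 F [[|x xr] [[|y wr] [wd [t1 [[EC //= [Sx] [Sw] Sd EP]]]]]].
move=> [/arr_cons[Ex Ax] EQ AW E5] [EK G] Esc.
have /arr_cat[Awd /arr_cons[Ey Aw]] := AW.
have F1 : r1 rOne = 1 by rewrite F.
have HP1 : r1 rP < W + size xs by rewrite EP; lia.
rewrite -EP in Ey Aw.
apply: (runs_seq (scan_stepP F1 HP1 EK Ex Ey G)) => r2 m2 F2.
case: (scan1 _ _ _ _) Esc => [[y' n'] t2] Esc [E1 E2 E3 E4 E6].
apply: runs_block => //=.
have [F29 F21] : r2 rCnt = k.+1 /\ r2 rOne = 1 by rewrite !F2.
have [F2Q F2P] : r2 rQ = r1 rQ /\ r2 rP = r1 rP by rewrite !F2.
rewrite F29 F21 F2Q F2P subn1 /= {F29}.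
have A2 : arr m2 W (wd ++ y' :: wr).
  apply/arr_cat; split.
    by apply: eq_arr Awd _ => i Hi; rewrite E6 //; lia.
  rewrite -EP; apply/arr_cons; split=> //.
  by apply: eq_arr Aw _ => i Hi; rewrite E6 //; lia.
have A3 a : (a < W) || (W + size xs <= a) -> m2 a = m a.
  by move=> Ha; rewrite E6 ?E5 //; lia.
case: k => [|k] in EC Sx Sw Sd * => /=.
  move: Esc A2; rewrite (size0nil Sx) (size0nil Sw) /= => -[-> -> ->] A2.
  by split.
exists k => //; exists xr, wr, (rcons wd y'), t2; rewrite cat_rcons size_rcons.
rewrite E1; move: Esc; case: (scan _ _ _ _) => [[ws'' n''] t''] [-> -> ->].
split; rewrite ?cat_rcons //; split=> //.
- lia.
- by rewrite EP addn1 addnS.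
- by apply: eq_arr Ax _ => i Hi; rewrite E6 //; rewrite EP; lia.
- by move: EQ; rewrite Sx; lia.
Qed.

(** A first pass counts the mismatches, a second one fixes columns. Leftover needs accumulate in
    [rFail], so a failed trial needs no early exit. Registers are copied by adding a register that
    holds 0. *)
Definition row_body : cmd :=
  Block [:: Iconst rE 0; Iadd rQ rRow rE; Iadd rP rW rE; Iadd rCnt rL rE] ;;
  mism_loop ;;
  Block [:: Iload rX rRadius; Isub rNeed rE rX; Iconst rT 0; Iadd rQ rRow rT;
            Iadd rP rW rT; Iadd rCnt rL rT] ;;
  scan_loop ;;
  Block [:: Iadd rRow rRow rL; Iadd rFail rFail rNeed;
            Iadd rRadius rRadius rOne; Isub rRows rRows rOne].

Definition row_loop : cmd := Loop row_body rRows.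

Lemma row_bodyP d xs ws t l W r m : 0 < l -> size xs = l -> size ws = l ->
  r rOne = 1 -> r rL = l -> r rW = W -> m (r rRadius) = d ->
  arr m (r rRow) xs -> r rRow + l <= W -> arr m W ws ->
  W + l <= r rK -> guess_at m (r rK) (r rSkip) t ->
  runs row_body r m (l * 33 + 14) (fun r' m' =>
    let: (ws', need', t') := scan xs ws (mism xs ws - d) t in
    [/\ [/\ r' rFail = r rFail + need', r' rRow = r rRow + l,
            r' rRadius = r rRadius + 1 & r' rRows = r rRows - 1],
        W + l <= r' rK, guess_at m' (r' rK) (r' rSkip) t', arr m' W ws' &
        forall a, (a < W) || (W + l <= a) -> m' a = m a]).
Proof.
move=> Hl Sx Sw H1 HL HW Hd AQ HQ AW HK HG.
apply: (@runs_le _ _ _ (4 + (l * 14 + (6 + (l * 19 + 4))))); last by lia.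
apply: runs_cons => //=; rewrite addn0 -Sx.
apply: runs_seq.
  by apply: (mism_loopP (ws := ws)) => //=; rewrite ?addn0 ?HW ?HL ?Sx.
move=> r1 m1 F1 [-> E1]; apply: runs_cons => //=.
have G1 q : q \in [:: rOne; rL; rW; rRadius; rRow; rK; rSkip; rFail; rRows] ->
    r1 q = r q.
  by move=> Hq; apply/eqP; move: q Hq; apply/allP; rewrite /= !F1 //= !eqxx.
rewrite E1 !G1 // Hd; apply: runs_seq.
  by apply: (scan_loopP (ws := ws) (t := t) (W := W)) => //=;
    rewrite ?addn0 ?G1 // ?HW ?HL ?Sx.
move=> r2 m2 F2 /=; rewrite Sx; case: (scan _ _ _ _) => [[ws' n'] t'].
move=> [E2 E3 E4 E5 E6]; apply: runs_block => //=.
have G2 q : q \in [:: rOne; rL; rRadius; rRow; rFail; rRows] -> r2 q = r q.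
  by move=> Hq; apply/eqP; move: q Hq; apply/allP;
    rewrite /= !F2 //= !G1 // !eqxx.
by split=> //; rewrite E2 !G2 // H1 HL.
Qed.

Lemma row_loopP ds xss ws t l W r m : 0 < l -> 0 < size ds ->
  size xss = size ds -> all (fun xs => size xs == l) xss -> size ws = l ->
  r rOne = 1 -> r rL = l -> r rW = W -> r rRows = size ds -> r rFail = 0 ->
  arr m (r rRadius) ds -> r rRadius + size ds <= W ->
  arr m (r rRow) (flatten xss) -> r rRow + size ds * l <= W ->
  arr m W ws -> W + l <= r rK -> guess_at m (r rK) (r rSkip) t ->
  runs row_loop r m (size ds * (l * 33 + 15)) (fun r' m' =>
    (r' rFail == 0) = sim ds xss ws t /\
    forall a, (a < W) || (W + l <= a) -> m' a = m a).
Proof.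
move=> Hl Hds Hxss Hall Hws H1 HL HW HR HF Ad Hd Ax Hx Aw HK HG.
rewrite -[X in runs _ _ _ (X * _)](prednK Hds) addnS.
(* The verdict of the whole trial is that no row has failed so far and that the remaining rows
   succeed. *)
apply: (runs_loop (I := fun k r1 m1 => exists ds1 xss1 ws1 t1,
  [/\ [/\ r1 rRows = k.+1, size ds1 = k.+1, size xss1 = k.+1,
          all (fun xs => size xs == l) xss1 & size ws1 = l],
      [/\ arr m1 (r1 rRadius) ds1, r1 rRadius + size ds1 <= W,
          arr m1 (r1 rRow) (flatten xss1) & r1 rRow + size ds1 * l <= W],
      [/\ arr m1 W ws1, W + l <= r1 rK & guess_at m1 (r1 rK) (r1 rSkip) t1],
      forall a, (a < W) || (W + l <= a) -> m1 a = m a &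
      (r1 rFail == 0) && sim ds1 xss1 ws1 t1 = sim ds xss ws t])); last first.
  by exists ds, xss, ws, t; rewrite prednK // Hxss HF.
move=> k r1 m1 F [[|d ds1] [[|xs xss1] [ws1 [t1 [[ER //= [Sd] [Sx] Hall1 Sw]]]]]].
move: Hall1 => /andP[/eqP Sxs Hall1].
move=> [/arr_cons[Ed Ad1] Hd1 /arr_cat[Ax1 Axs1] Hx1] [Aw1 EK EG] E5 Esim.
have [F1 FL FW] : [/\ r1 rOne = 1, r1 rL = l & r1 rW = W] by rewrite !F.
apply: runs_weaken
  (@row_bodyP d xs ws1 t1 l W r1 m1 _ _ _ _ _ _ _ _ _ _ _ _) _ _ => //.
  by move: Hx1; rewrite mulSn; lia.
move=> r2 m2 _; have := size_scan xs ws1 (mism xs ws1 - d) t1.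
move: Esim; case: (scan _ _ _ _) => [[ws2 n2] t2] /= Esim Sw2.
move=> [[EF2 ER2 ERad ERows] EK2 EG2 Aw2 E6].
have A3 a : (a < W) || (W + l <= a) -> m2 a = m a.
  by move=> Ha; rewrite E6 ?E5.
rewrite ERows ER subn1 /=.
case: k => [|k] in ER ERows Sd Sx *; rewrite /=.
  split=> //; rewrite -Esim (size0nil Sd) /= EF2 andbT addn_eq0 //.
exists k => //; exists ds1, xss1, ws2, t2; split=> //.
- by split=> //; rewrite Sw2.
- rewrite ERad ER2 Sd; split.
  + by apply: eq_arr Ad1 _ => i Hi; rewrite E6 //; lia.
  + by move: Hd1; rewrite Sd; lia.
  + apply: eq_arr; first by rewrite Sxs in Axs1; exact: Axs1.
    rewrite (size_flatten_const Hall1) Sx -Sd.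
    by move=> i Hi; rewrite E6 //; move: Hx1; rewrite mulSn; lia.
  + by move: Hx1; rewrite mulSn Sd; lia.
- by rewrite EF2 addn_eq0 -Esim andbA.
Qed.

(** * Enumeration of the guesses *)

Definition inc_loop : cmd :=
  Loop (Block [:: Iload rX rP; Iadd rX rX rCarry; Isub rCarry rX rD;
                  Isub rT rOne rCarry] ;;
        Unless rT (Block [:: Iconst rX 0]) ;;
        Block [:: Istore rP rX; Iadd rP rP rOne; Isub rCnt rCnt rOne]) rCnt.

(** [Unless] acts on 0, so the digit is reset under [1 - carry], which is 0 exactly on overflow. *)
Lemma inc_loopP D B b r m : 0 < size b -> r rOne = 1 -> r rD = D -> r rP = B ->
  r rCnt = size b -> arr m B b ->
  runs inc_loop r m (size b * 10) (fun r' m' =>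
    let: (carry, b') := inc D (r rCarry) b in
    [/\ r' rCarry = carry, arr m' B b' &
        forall a, (a < B) || (B + size b <= a) -> m' a = m a]).
Proof.
move=> Hb H1 HD HP HC A; rewrite -[X in runs _ _ _ (X * _)](prednK Hb).
case Einc: (inc D (r rCarry) b) => [cF bF].
apply: (runs_loop (I := fun k r1 m1 => exists bd br,
  [/\ [/\ r1 rCnt = k.+1, size br = k.+1, size bd + k.+1 = size b &
          r1 rP = B + size bd],
      arr m1 B (bd ++ br),
      forall a, (a < B) || (B + size b <= a) -> m1 a = m a &
      let: (c, b') := inc D (r1 rCarry) br in (cF, bF) = (c, bd ++ b')]));
  last first.
  by exists [::], b; rewrite prednK // addn0 Einc.
move=> k r1 m1 F [bd [[|x br]]] [[EC //= [Sb] Sbd EP] Ab E5 Einc1].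
have /arr_cat[Abd /arr_cons[Ex Ab1]] := Ab.
have [F1 FD] : r1 rOne = 1 /\ r1 rD = D by rewrite !F.
apply: (@runs_le _ _ _ (4 + (2 + 3))) => //; apply: runs_cons => //=.
rewrite EP Ex F1 FD.
apply: (runs_seq (Q1 := fun r' m' => r' rX = (inc1 D (r1 rCarry) x).2 /\ m' = m1)).
  apply: (@runs_unless _ _ _ _ 1) => /= HT.
    apply: runs_block => //=; split=> //.
    by case: ltnP => //; move: HT; lia.
  by split=> //; case: ltnP => //; move: HT; lia.
move=> r2 m2 F2 [EX ->]; apply: runs_block => //=.
have [F2P F2C] : r2 rP = B + size bd /\ r2 rCnt = k.+1 by rewrite !F2.
have [F21 F2c] : r2 rOne = 1 /\ r2 rCarry = x + r1 rCarry - D by rewrite !F2.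
rewrite F2P F2C F21 F2c subn1 EX /= {F2C}.
move: Einc1; set x' := if _ then _ else _ => Einc1.
have A2 : arr (upd m1 (B + size bd) x') B (bd ++ x' :: br).
  apply/arr_cat; split; last apply/arr_cons; rewrite ?upd_same; try split=> //.
    by apply: arr_upd Abd _; rewrite leqnn orbT.
  by apply: arr_upd Ab1 _; lia.
have A3 a : (a < B) || (B + size b <= a) -> upd m1 (B + size bd) x' a = m a.
  by move=> Ha; rewrite upd_other ?E5 //; lia.
case: k => [|k] in EC Sb Sbd * => /=.
  by move: Einc1 A2; rewrite (size0nil Sb) /= => -[-> ->].
exists k => //; exists (rcons bd x'), br; rewrite cat_rcons size_rcons.
move: Einc1; case: (inc _ _ _) => c'' b'' [-> ->].
by split; rewrite ?cat_rcons //; split=> //; lia.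
Qed.

(** The constant 3 is the address of the radii, after the three sizes. The final [rT] is positive
    exactly while the trial fails and the counter has not wrapped around. *)
Definition guess_body : cmd :=
  Block [:: Iconst rT 0; Iadd rP rW rT; Iadd rCnt rL rT] ;;
  clear_loop ;;
  Block [:: Iconst rFail 0; Iadd rK rB rFail; Iload rSkip rK;
            Iconst rRadius 3; Iadd rRow rRadius rN; Iadd rRows rN rFail] ;;
  row_loop ;;
  Block [:: Isub rAns rOne rFail; Iconst rCarry 1; Iconst rT 0;
            Iadd rP rB rT; Iadd rCnt rL rT] ;;
  inc_loop ;;
  Block [:: Isub rT rOne rCarry; Isub rT rT rAns].

Definition guess_loop : cmd := Loop guess_body rT.

(* Memory: the input, then at [rW] the partial vector, at [rB] the guess, and
   zeros. *)
Definition instance_at (ds : seq nat) (xss : seq (seq nat)) (l : nat)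
    (r m : nat -> nat) : Prop :=
  let n := size ds in
  [/\ [/\ r rOne = 1, r rN = n & r rL = l],
      r rW = 3 + n + n * l /\ r rB = 3 + n + n * l + l,
      arr m 3 ds /\ arr m (3 + n) (flatten xss) &
      forall a, 3 + n + n * l + l + l <= a -> m a = 0].

Lemma guess_bodyP D ds xss l b r m : 0 < l -> 0 < size ds ->
  size xss = size ds -> all (fun xs => size xs == l) xss -> size b = l ->
  instance_at ds xss l r m -> r rD = D -> arr m (r rB) b ->
  runs guess_body r m (size ds * (l * 33 + 15) + l * 14 + 16) (fun r' m' =>
    let: (carry, b') := inc D 1 b in
    [/\ instance_at ds xss l r' m', arr m' (r' rB) b',
        r' rAns = sim ds xss (nseq l 0) b &
        r' rT = 1 - carry - sim ds xss (nseq l 0) b]).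
Proof.
move=> Hl Hds Hxss Hall Sb [[H1 HN HL] [HW HB] [Ad Ax] H0] HD Ab.
set n := size ds in Hxss HN HW HB Ax H0 *.
set W := 3 + n + n * l in HW HB H0.
apply: (@runs_le _ _ _ (3 + (l * 4 + (6 + (n * (l * 33 + 15) +
  (5 + (l * 10 + 2))))))); last by lia.
apply: runs_cons => //=.
apply: (runs_seq (@clear_loopP l W _ _ _ _ _ _ _)) => //=; rewrite ?addn0 //.
move=> r1 m1 F1 [A1 E1]; apply: runs_cons => //=.
have [G1 G2 G3] : [/\ r1 rN = n, r1 rB = W + l & r1 rOne = 1] by rewrite !F1.
have [G4 G5 G6] : [/\ r1 rW = W, r1 rL = l & r1 rD = D] by rewrite !F1.
rewrite G1 G2 !addn0.
have Sflat : size (flatten xss) = n * l.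
  by rewrite (size_flatten_const Hall) Hxss.
have Ab1 : arr m1 (W + l) b.
  by rewrite -HB; apply: eq_arr Ab _ => i Hi; rewrite E1 //; lia.
have M0 a : W + l + l <= a -> m1 a = 0 by move=> Ha; rewrite E1 ?H0 //; lia.
apply: runs_seq.
  apply: (@row_loopP ds xss (nseq l 0) b l W) => //=.
  - by rewrite size_nseq.
  - by apply: eq_arr Ad _ => i Hi; rewrite E1 // /W; lia.
  - by rewrite /W -/n; lia.
  - by apply: eq_arr Ax _ => i Hi; rewrite E1 // /W; lia.
  (* The cells after the guess are 0, which matches the default value of [nth]. *)
  - have M i : m1 (W + l + i) = nth 0 b i.
      case: (ltnP i (size b)) => Hi; first exact: Ab1.
      by rewrite nth_default // M0 //; lia.
    split; first by rewrite -nth0 -M addn0.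
    by move=> i; rewrite M nth_behead.
move=> r2 m2 F2 [EF E2]; apply: runs_cons => //=.
have [I1 I2 I3] : [/\ r2 rN = n, r2 rB = W + l & r2 rOne = 1] by rewrite !F2.
have [I4 I5 I6] : [/\ r2 rW = W, r2 rL = l & r2 rD = D] by rewrite !F2.
rewrite I2 I3 I5 !addn0; rewrite -[in X in runs _ _ _ X]Sb.
apply: runs_seq.
  apply: (@inc_loopP D (W + l) b) => //=; rewrite ?Sb //.
  by apply: eq_arr Ab1 _ => i Hi; rewrite E2 //; lia.
move=> r3 m3 F3 /=; case: (inc _ _ _) => carry b' [EC A3 E3].
apply: runs_block => //=; rewrite EC.
have J1 : r3 rOne = 1 by rewrite F3.
have J2 : r3 rB = W + l by rewrite F3.
(* Truncation in [1 - rFail] sends every positive [rFail] to the answer 0. *)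
have J3 : r3 rAns = sim ds xss (nseq l 0) b.
  by rewrite F3 //= -EF; case: (r2 _) => [|[]].
rewrite J1 J2 J3; split=> //; split.
- by rewrite /= !F3.
- by rewrite /= !F3.
- split; [apply: eq_arr Ad _|apply: eq_arr Ax _] => i Hi;
    rewrite E3 ?E2 ?E1 // /W; lia.
- move=> a Ha; rewrite E3 ?E2 ?M0 // /W; lia.
Qed.

Lemma guess_loopP D ds xss l r m : 0 < l -> 0 < size ds ->
  size xss = size ds -> all (fun xs => size xs == l) xss ->
  instance_at ds xss l r m -> r rD = D -> arr m (r rB) (nseq l 0) ->
  runs guess_loop r m (D.+1 ^ l * (size ds * (l * 33 + 15) + l * 14 + 17))
    (fun r' m' => forall a : bool, (accepted D ds xss l <-> a) -> r' rAns = a).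
Proof.
move=> Hl Hds Hxss Hall Hinst HD Hb.
have Hpow : 0 < D.+1 ^ l by rewrite expn_gt0.
rewrite -[X in runs _ _ _ (X * _)](prednK Hpow) [_ + 17]addnS.
(* [k.+1] guesses remain, the current one included, and all guesses of smaller value have failed. *)
apply: (runs_loop (I := fun k r1 m1 => exists b,
  [/\ size b = l /\ all (leq^~ D) b, value D b + k.+1 = D.+1 ^ l,
      instance_at ds xss l r1 m1, arr m1 (r1 rB) b &
      forall b', size b' = l -> all (leq^~ D) b' -> value D b' < value D b ->
        ~~ sim ds xss (nseq l 0) b'])); last first.
  exists (nseq l 0).
  have V0 : value D (nseq l 0) = 0.
    by elim: (l) => //= j ->; rewrite muln0.
  by rewrite size_nseq all_nseq orbT V0 prednK.
move=> k r1 m1 F [b [[Sb Db] Hk Hi1 Ab Hno]].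
have F1 : r1 rD = D by rewrite F.
apply: runs_weaken (guess_bodyP Hl Hds Hxss Hall Sb Hi1 F1 Ab) _ _ => //.
move=> r2 m2 _; have := @incP D 1 b Db isT.
case: (inc D 1 b) => carry b' [Hc Sb' Db' Hv] [Hi2 Ab2 EA ET].
rewrite ET; case: eqP => HT.
  move=> a Ha; rewrite EA; congr nat_of_bool; case Hsim: (sim _ _ _ _) HT.
    by move=> _; case: Ha => Ha _; rewrite Ha //; exists b.
  (* A wrap-around means that [b] had the largest value, so every guess has been tried. *)
  move=> HT; have Ec : carry = 1 by lia.
  rewrite Ec mul1n Sb in Hv; apply/esym/negP=> Ha'.
  have [b1 [S1 D1 T1]] := Ha.2 Ha'.
  have := value_lt D1; rewrite S1 => Hlt.
  case: (ltngtP (value D b1) (value D b)) => [Hlt'|Hgt|Heq].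
  - by move: (Hno b1 S1 D1 Hlt'); rewrite T1.
  - by lia.
  - have E1 : b1 = b by apply: (value_inj _ D1 Db Heq); rewrite S1.
    by move: T1; rewrite E1 Hsim.
case Hsim: (sim _ _ _ _) HT; first by move=> /= ?; lia.
move=> HT; have Ec : carry = 0 by lia.
rewrite Ec mul0n addn0 in Hv.
have := value_lt Db'; rewrite Sb' Sb => Hlt.
exists k.-1; first by lia.
exists b'; split=> //.
- by rewrite Sb'.
- by lia.
- move=> b1 S1 D1; rewrite Hv addn1 ltnS leq_eqVlt => /orP[/eqP E1|].
    have -> : b1 = b by apply: (value_inj _ D1 Db E1); rewrite S1.
    by rewrite Hsim.
  exact: Hno.
Qed.

(** * The complete program and its cost *)

Definition radius_loop : cmd :=
  Loop (Block [:: Iload rX rP; Isub rT rX rD; Iadd rD rD rT; Iadd rW rW rL;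
                  Iadd rP rP rOne; Isub rCnt rCnt rOne]) rCnt.

(** Adding the truncated [x - rD] to [rD] yields the maximum; adding [l] to [rW] once per radius
    replaces the multiplication of [n] by [l]. *)
Lemma radius_loopP ds l w r m : 0 < size ds ->
  r rOne = 1 -> r rL = l -> r rD = 0 -> r rW = w -> r rCnt = size ds ->
  arr m (r rP) ds ->
  runs radius_loop r m (size ds * 7) (fun r' m' =>
    [/\ m' = m, r' rD = \max_(d <- ds) d & r' rW = w + size ds * l]).
Proof.
move=> Hs H1 HL HD HW HC A; rewrite -[X in runs _ _ _ (X * _)](prednK Hs).
apply: (runs_loop (I := fun k r1 m1 => exists ds1,
  [/\ m1 = m /\ r1 rCnt = k.+1, size ds1 = k.+1, arr m (r1 rP) ds1,
      maxn (r1 rD) (\max_(d <- ds1) d) = \max_(d <- ds) d &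
      r1 rW + size ds1 * l = w + size ds * l])); last first.
  by exists ds; rewrite prednK // HD max0n HW.
move=> k r1 m1 F [[|d ds1] [[-> EC] //= [Sd] /arr_cons[Ed Ad] EM EW]].
have [F1 FL] : r1 rOne = 1 /\ r1 rL = l by rewrite !F.
apply: runs_block => //=; rewrite EC Ed F1 FL subn1 /=.
rewrite big_cons maxnA [maxn _ d]maxnE in EM; rewrite mulSn addnA in EW.
case: k => [|k] in EC Sd * => /=.
  move: EM EW; rewrite (size0nil Sd) big_nil maxn0 mul0n addn0 => <- <-.
  by split.
by exists k => //; exists ds1.
Qed.

(** Loops run at least once, so empty cases are settled first: yes for [l = 0], no for an empty
    alphabet with [l] positive, and otherwise yes for [n = 0]. *)
Definition conrmc_cmd : cmd :=
  Block [:: Iconst rOne 1; Iconst rT 0; Iload rN rT; Iload rL rOne;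
            Iadd rT rOne rOne; Iload rSigma rT; Isub rAns rOne rL] ;;
  Unless rAns
   (Block [:: Isub rT rOne rSigma] ;;
    Unless rT
     (Block [:: Isub rAns rOne rN] ;;
      Unless rAns
       (Block [:: Iconst rD 0; Iconst rP 3; Iadd rW rP rN; Iadd rCnt rN rD] ;;
        radius_loop ;;
        Block [:: Iadd rB rW rL] ;;
        guess_loop))).

(** Each of [1], [n], [P], [P * n] and [P * l] is at most [P * (n * l)], and the coefficients sum to
    103. *)
Lemma cost_bound (P n l : nat) : 0 < P -> 0 < n -> 0 < l ->
  7 + (1 + (1 + (4 + (n * 7 + (1 + P * (n * (l * 33 + 15) + l * 14 + 17)))).+1).+1).+1
  <= 120 * maxn 1 (P * (n * l)).
Proof.
move=> HP Hn Hl.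
have [H1 H2] : 0 < n * l /\ n <= n * l by rewrite muln_gt0 Hn Hl leq_pmulr.
have [H3 H4] : P <= P * (n * l) /\ n * l <= P * (n * l).
  by rewrite leq_pmulr ?leq_pmull.
have [H5 H6] : P * n <= P * (n * l) /\ P * l <= P * (n * l).
  by rewrite !leq_mul2l H2 leq_pmull ?orbT.
have -> : P * (n * (l * 33 + 15) + l * 14 + 17) =
    33 * (P * (n * l)) + 15 * (P * n) + 14 * (P * l) + 17 * P by nia.
lia.
Qed.

Lemma conrmc_cmdP s l ds xss (a : bool) m :
  size xss = size ds ->
  all (fun xs => (size xs == l) && all (leq^~ s) xs) xss ->
  m = (fun i => nth 0 ([:: size ds; l; s] ++ ds ++ flatten xss) i) ->
  (feasible s l ds xss <-> a) ->
  runs conrmc_cmd (fun=> 0) m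
    (120 * maxn 1 ((\max_(d <- ds) d + 1) ^ l * (size ds * l)))
    (fun r' m' => r' rAns = a).
Proof.
set n := size ds; set D := \max_(d <- ds) d => Hxss Hall Em Ha.
have Hpow : 0 < D.+1 ^ l by rewrite expn_gt0.
have Hds : all (leq^~ D) ds.
  by apply/allP => d Hd; apply: (leq_bigmax_seq (F := id)).
have Hall' : all (fun xs => size xs == l) xss.
  by apply: sub_all Hall => xs /andP[].
have Am : arr m 0 ([:: n; l; s] ++ ds ++ flatten xss) by move=> i Hi; rewrite Em.
have [A0 /arr_cat[Ad Ax]] := (arr_cat _ _ _ _).1 Am.
have [En El Es] : [/\ m 0 = n, m 1 = l & m 2 = s] by rewrite Em.
have Sflat : size (flatten xss) = n * l.
  by rewrite (size_flatten_const Hall') Hxss.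
have M0 i : 3 + n + n * l <= i -> m i = 0.
  by move=> Hi; rewrite Em nth_default // !size_cat /= Sflat -/n; lia.
rewrite addn1.
case: (posnP l) => Hl.
  apply: (@runs_le _ _ _ (7 + 1)); last by lia.
  apply: runs_cons => //=; rewrite En El Es Hl.
  apply: (@runs_unless _ _ _ _ 0) => //= _.
  case: a Ha => //= Ha; suff: false by []. apply/Ha; exists [::]; split=> //.
  rewrite /within_radii all2E Hxss eqxx; apply/allP => -[d xs] _ /=.
  by rewrite /mism; case: xs.
case: (posnP s) => Hs.
  apply: (@runs_le _ _ _ (7 + (1 + 1).+1)); last by lia.
  apply: runs_cons => //=; rewrite En El Es Hs.
  apply: (@runs_unless _ _ _ _ 2) => /= HL; last by lia.
  apply: runs_cons => //=; apply: (@runs_unless _ _ _ _ 0) => //= _.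
  rewrite HL; case: a Ha => // Ha; have [[|y v] [Sv Av _]] := Ha.2 isT.
    by move: Sv Hl => /= <-.
  by move: Av; rewrite Hs /= => /andP[]; lia.
case: (posnP n) => Hn.
  apply: (@runs_le _ _ _ (7 + (1 + (1 + 1).+1).+1)); last by lia.
  apply: runs_cons => //=; rewrite En El Es.
  apply: (@runs_unless _ _ _ _ _) => /= HL; last by lia.
  apply: runs_cons => //=; apply: (@runs_unless _ _ _ _ _) => /= HS; last by lia.
  apply: runs_cons => //=; apply: (@runs_unless _ _ _ _ 0) => /= HN.
    by lia.
  rewrite Hn; case: a Ha => //= Ha; suff: false by []. apply/Ha.
  exists (nseq l 1); rewrite size_nseq all_nseq /= Hs orbT; split=> //.
  by rewrite (size0nil Hn) (size0nil (etrans Hxss Hn)).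
apply: (@runs_le _ _ _ (7 + (1 + (1 + (4 + (n * 7 +
  (1 + (D.+1 ^ l * (n * (l * 33 + 15) + l * 14 + 17))))).+1).+1).+1)); last first.
  exact: cost_bound.
apply: runs_cons => //=; rewrite En El Es.
apply: runs_unless => /= HL; last by lia.
apply: runs_cons => //=; apply: runs_unless => /= HS; last by lia.
apply: runs_cons => //=; apply: runs_unless => /= HN; last by lia.
apply: runs_cons => //=; apply: runs_seq.
  by apply: (@radius_loopP ds l (3 + n)) => //=; rewrite addn0.
move=> r1 m1 F1 [-> ED EW]; apply: runs_cons => //=; rewrite EW.
have [G1 G2 G3] : [/\ r1 rOne = 1, r1 rN = n & r1 rL = l] by rewrite !F1.
rewrite G3; apply: runs_weaken
  (@guess_loopP D ds xss l _ _ _ _ _ _ _ _ _) _ _ => //=.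
- by split=> //= i Hi; apply: M0; rewrite -/n in Hi; lia.
- by move=> i Hi; rewrite size_nseq in Hi; rewrite nth_nseq Hi M0 // -/n; lia.
- move=> r' m' _; apply; rewrite -Ha; exact: accepted_feasibleP.
Qed.

(** * From entry codes back to matrices *)

Definition row_codes (Sigma : finType) (n l : nat)
    (S : 'M[option Sigma]_(n, l)) (i : 'I_n) : seq nat :=
  [seq entry_code (S i j) | j <- enum 'I_l].

(** Symbols have positive codes, so 0 marks just the missing entries of the row, and the complete
    vector has none. *)
Lemma mism_delta (Sigma : finType) (n l : nat) (S : 'M[option Sigma]_(n, l))
    (v : 'rV[Sigma]_l) i :
  mism (row_codes S i) [seq (enum_rank (v ord0 j)).+1 | j <- enum 'I_l] =
  delta (map_mx Some v) (row i S).
Proof.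
rewrite /mism /row_codes zip_map count_map /delta -sum1_count big_enum_cond /=.
rewrite -[RHS]sum1_card; apply: eq_bigl => j; rewrite !inE !mxE /=.
case: (S i j) => [a|] //=.
by rewrite andbT eqSS (inj_eq (@ord_inj _)) (inj_eq enum_rank_inj) eq_sym.
Qed.

Lemma conrmcP (Sigma : finType) (n l : nat) (S : 'M[option Sigma]_(n, l))
    (d : 'I_n -> nat) :
  feasible #|Sigma| l [seq d i | i <- enum 'I_n]
    [seq row_codes S i | i <- enum 'I_n] <-> conrmc S d.
Proof.
have radii (v : 'rV[Sigma]_l) : within_radii [seq d i | i <- enum 'I_n]
    [seq row_codes S i | i <- enum 'I_n]
    [seq (enum_rank (v ord0 j)).+1 | j <- enum 'I_l] =
    [forall i, delta (map_mx Some v) (row i S) <= d i].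
  rewrite /within_radii all2E !size_map eqxx zip_map all_map /=.
  apply/allP/forallP => H i.
    by have := H i (mem_enum _ _); rewrite /= mism_delta.
  by move=> _; rewrite /= mism_delta.
split=> [[v [Sv Hv Hr]]|/existsP[v Hv]].
  (* A code between 1 and the alphabet size decodes to the symbol whose rank is one less. *)
  have /fin_all_exists[f Hf] (j : 'I_l) :
      exists a : Sigma, nth 0 v j = (enum_rank a).+1.
    have : nth 0 v j \in v by rewrite mem_nth ?Sv.
    move=> /(allP Hv)/=/andP[H0 H1].
    have H2 : (nth 0 v j).-1 < #|Sigma| by rewrite prednK.
    by exists (enum_val (Ordinal H2)); rewrite enum_valK /= prednK.
  apply/existsP; exists (\row_j f j)%R; rewrite -radii.
  suff -> : [seq (enum_rank ((\row_j f j)%R ord0 j)).+1 | j <- enum 'I_l] = v by [].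
  apply: (@eq_from_nth _ 0); first by rewrite size_map size_enum_ord Sv.
  move=> k; rewrite size_map size_enum_ord => Hk.
  by rewrite (nth_map (Ordinal Hk)) ?size_enum_ord // mxE -Hf nth_enum_ord.
exists [seq (enum_rank (v ord0 j)).+1 | j <- enum 'I_l]; split.
- by rewrite size_map size_enum_ord.
- by rewrite all_map; apply/allP => j _ /=.
- by rewrite radii.
Qed.

Theorem theorem5 :
  exists (p : program) (C : nat),
    forall (Sigma : finType) (n l : nat)
           (S : 'M[option Sigma]_(n, l)) (d : 'I_n -> nat),
      let dmax := \max_(i < n) d i in
      (* [maxn 1] only matters when n = 0 or l = 0. *)
      decides_within p (encode S d)
        (C * maxn 1 ((dmax + 1) ^ l * (n * l))) (conrmc S d).
Proof.
exists (compile 0 conrmc_cmd), 120 => Sigma n l S d dmax.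
pose ds := [seq d i | i <- enum 'I_n].
pose xss := [seq row_codes S i | i <- enum 'I_n].
have Sds : size ds = n by rewrite size_map size_enum_ord.
have Hxss : all (fun xs => (size xs == l) && all (leq^~ #|Sigma|) xs) xss.
  rewrite all_map; apply/allP => i _ /=.
  rewrite size_map size_enum_ord eqxx all_map; apply/allP => j _ /=.
  by case: (S i j) => //= a.
(* The double comprehension in [encode] is by definition the flattened list of coded rows. *)
have Em : (fun a => nth 0 (encode S d) a) =
    (fun a => nth 0 ([:: size ds; l; #|Sigma|] ++ ds ++ flatten xss) a).
  by rewrite Sds.
have Hsz : size xss = size ds by rewrite !size_map.
have Dmax : \max_(x <- ds) x = dmax by rewrite big_map big_enum.
have [t [r [m [Ht E _ Hr]]]] := conrmc_cmdP Hsz Hxss Em (conrmcP S d)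
  (code_at_self (compile 0 conrmc_cmd)).
exists t; rewrite /init E; split=> //.
by rewrite -Sds -Dmax.
Qed.
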